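(* Let $k\ge 2$ and $n\ge 1$ be integers, let $t=(t_1,\dots,t_k)$ be complex numbers with $t_2\neq 0$, and put $t_0=1$. Let $\mathrm{i}=\sqrt{-1}$ and let $H_{k,n}=(h_{rs})$ be the $n\times n$ lower Hessenberg matrix with $$h_{rs}=\begin{cases}\mathrm{i}^{\,r-s}\,\dfrac{t_{r-s+1}}{t_2^{\,r-s}} & \text{if } s\neq 1 \text{ and } -1\le r-s<k,\\[2mm] \mathrm{i}^{\,r-s}\,\dfrac{t_{r-s+1}}{t_2^{\,r-s}}\,(r-s+1) & \text{if } s=1 \text{ and } -1\le r-s<k,\\[2mm] 0 & \text{otherwise.}\end{cases}$$ Then $\operatorname{per}(H_{k,n})=G_{k,n}(t)$, where $G_{k,n}(t)$ is the generalized Lucas polynomial.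
   Context: The permanent of an $n\times n$ matrix $A=(a_{ij})$ is $\operatorname{per}(A)=\sum_{\sigma\in S_n}\prod_{i=1}^n a_{i,\sigma(i)}$. The generalized Fibonacci polynomials $F_{k,n}(t)$, $t=(t_1,\dots,t_k)$, are defined by $F_{k,n}(t)=0$ for $n<1$, $F_{k,1}(t)=1$, and $F_{k,n+1}(t)=t_1F_{k,n}(t)+\cdots+t_kF_{k,n-k+1}(t)$ for $n\ge 1$. The generalized Lucas polynomials are given by $G_{k,0}(t)=k$ and $G_{k,n}(t)=\sum_{j=1}^{k} j\,t_j\,F_{k,n-j+1}(t)$ for $n\ge 1$. A matrix $(a_{rs})$ is lower Hessenberg if $a_{rs}=0$ whenever $s-r>1$. *)

(* Defs.v *)
From mathcomp Require Import all_boot all_order all_algebra perm zify.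
From mathcomp Require Import reals complex.
Set Implicit Arguments.
Unset Strict Implicit.
Unset Printing Implicit Defensive.
Import Order.TTheory GRing.Theory Num.Theory.
Local Open Scope ring_scope.

Definition permanent (A : comNzRingType) (n : nat) (M : 'M[A]_n) : A :=
  \sum_(s : 'S_n) \prod_(i < n) M i (s i).

Definition lower_hessenberg (A : comNzRingType) (n : nat) (M : 'M[A]_n) : Prop :=
  forall r s : 'I_n, 1 < s%:Z - r%:Z -> M r s = 0.

Section Fibonacci.
Variables (A : comNzRingType) (k : nat) (t : k.-tuple A).

(* [tcoef j] is t_j, with the convention t_0 = 1. *)
Definition tcoef (j : nat) : A := nth 0 (1 :: t) j.

(* [fib_hist n] is the list F_n, F_(n-1), ..., F_1: the recurrence has order k,
   so all the previous values are kept; reading past the end of the list gives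
   the values F_m = 0 for m < 1. *)
Fixpoint fib_hist (n : nat) : seq A :=
  if n is m.+1 then
    (if m is 0 then 1
     else \sum_(1 <= j < k.+1) tcoef j * nth 0 (fib_hist m) j.-1) :: fib_hist m
  else [::].

Definition genFib (n : int) : A :=
  if n is Posz m then head 0 (fib_hist m) else 0.

Definition genLucas (n : nat) : A :=
  if n is 0 then k%:R
  else \sum_(1 <= j < k.+1) j%:R * tcoef j * genFib (n%:Z - j%:Z + 1).

Lemma genFib_lt1 (n : int) : n < 1 -> genFib n = 0.
Proof. by case: n => [[|m]|m]. Qed.

Lemma genFib1 : genFib 1 = 1.
Proof. by []. Qed.

Lemma nth_fib_hist (m i : nat) :
  nth 0 (fib_hist m) i = genFib (m%:Z - i%:Z).
Proof.
elim: m i => [|m IHm] [|i]; first by [].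
- by rewrite nth_nil genFib_lt1 //; lia.
- by rewrite subr0.
- have -> : m.+1%:Z - i.+1%:Z = m%:Z - i%:Z by lia.
  exact: IHm.
Qed.

Lemma genFib_rec (n : int) : 1 <= n ->
  genFib (n + 1) = \sum_(1 <= j < k.+1) tcoef j * genFib (n - j%:Z + 1).
Proof.
case: n => [[|m]|m] // _.
have -> : Posz m.+1 + 1 = Posz m.+2 by lia.
rewrite [LHS]/genFib [fib_hist m.+2]/= /head.
apply: eq_big_nat => j /andP[j1 _]; congr (_ * _).
have -> : Posz m.+1 - j%:Z + 1 = Posz m.+1 - j.-1%:Z by lia.
exact: (nth_fib_hist m.+1).
Qed.

End Fibonacci.

(* Rows and columns are numbered from 0: the first column is s = 0, and the
   difference r - s does not depend on the numbering. When -1 <= r - s the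
   integer r - s + 1 is nonnegative, so its absolute value is the index. *)
Definition Hmx (R : realType) (k : nat) (t : k.-tuple R[i]) (n : nat) :
    'M[R[i]]_n :=
  \matrix_(r < n, s < n)
    let d : int := r%:Z - s%:Z in
    let h : R[i] :=
      'i%C ^ d * (tcoef t `|(d + 1)%R|%N / tcoef t 2 ^ d) in
    if (-1 <= d) && (d < k%:Z) then
      if (s : nat) == 0%N then h * (d + 1)%:~R else h
    else 0.

Lemma Hmx_lower_hessenberg (R : realType) (k : nat) (t : k.-tuple R[i]) (n : nat) :
  lower_hessenberg (Hmx t n).
Proof.
move=> r s rs; rewrite mxE /=.
by rewrite (_ : (-1 <= r%:Z - s%:Z) = false) //; lia.
Qed.

(* Main.v *)
Require Import Defs.
From mathcomp Require Import all_boot all_order all_algebra perm.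
From mathcomp Require Import reals complex.
From mathcomp Require Import zify.
Set Implicit Arguments.
Unset Strict Implicit.
Unset Printing Implicit Defensive.
Import Order.TTheory GRing.Theory Num.Theory.
Local Open Scope ring_scope.

(** The matrix is Toeplitz except for its first column: it has a constant [a]
    on the superdiagonal, depends on [r - s] alone in the columns [s > 0], and
    has a first column that is free. Expand the permanent of such a matrix along
    its first row, which has only two nonzero entries. Deleting the first
    column leaves a pure Toeplitz Hessenberg matrix; deleting the second
    leaves a matrix of the same family, whose first column is the old one
    shifted by one. Iterating,
      [per_n(v) = \sum_(i < n) a^i v_i P_(n-1-i)],
    where [P_m] is the permanent of order [m] with the first column equal to
    the other ones ([permanent_toeplitz_hessenberg]).

    With [u = 'i / t_2], the entries are [u^d t_(d+1)] where [d = r - s], and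
    the superdiagonal [d = -1] is [u^-1] since [t_0 = 1]. The powers of [u]
    cancel in the formula: for the constant column it becomes the recurrence
    of the Fibonacci polynomials, so [P_m = F_(m+1)], and for the column
    [v_i = (i+1) u^i t_(i+1)] it becomes the sum that defines the Lucas
    polynomial. *)

Lemma lift_perm_inj (n : nat) (i j : 'I_n.+1) : injective (@lift_perm n i j).
Proof.
move=> u v uv; apply/permP => k; apply: (@lift_inj _ j).
by rewrite -!(lift_perm_lift i) uv.
Qed.

Lemma lift_perm_surj (n : nat) (i j : 'I_n.+1) (s : 'S_n.+1) :
  s i = j -> exists u : 'S_n, lift_perm i j u = s.
Proof.
move=> sij.
have f_ex k : {l | s (lift i k) = lift j l}.
  apply/sig_eqW; case: (unliftP j (s (lift i k))) => [l ->|]; first by exists l.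
  by rewrite -sij => /perm_inj/eqP; rewrite eq_sym (negPf (neq_lift i k)).
have f_inj : injective (fun k => sval (f_ex k)).
  move=> k k' e; apply: (@lift_inj _ i); apply: (@perm_inj _ s).
  by rewrite (svalP (f_ex k)) (svalP (f_ex k')) e.
exists (perm f_inj); apply/permP => k.
case: (unliftP i k) => [k'|] ->; last by rewrite lift_perm_id.
by rewrite lift_perm_lift permE -(svalP (f_ex k')).
Qed.

(** Grouping the permutations by the image of [i], each group is a copy of
    the symmetric group on one point less, through [lift_perm]. *)
Lemma expand_permanent_row (A : comNzRingType) (n : nat) (M : 'M[A]_n.+1)
    (i : 'I_n.+1) :
  permanent M = \sum_j M i j * permanent (row' i (col' j M)).
Proof.
rewrite /permanent (partition_big (fun s : 'S_n.+1 => s i) xpredT) //=.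
apply: eq_bigr => j _.
rewrite (reindex (@lift_perm n i j)); last first.
  exists (fun s => odflt 1%g [pick u | lift_perm i j u == s]).
    move=> u _; case: pickP => [v /eqP/lift_perm_inj //|/(_ u)].
    by rewrite eqxx.
  move=> s /eqP/lift_perm_surj[u <-].
  by case: pickP => [v /eqP //|/(_ u)]; rewrite eqxx.
rewrite big_distrr; apply: eq_big => [u|u _]; first by rewrite lift_perm_id eqxx.
rewrite (bigD1_ord i) //= lift_perm_id; congr (_ * _).
by apply: eq_bigr => k _; rewrite !mxE lift_perm_lift.
Qed.

(** The first column [v] is a parameter of its own because the expansion along
    the first row shifts it while leaving the Toeplitz columns as they are. *)
Definition toeplitz_hessenberg (A : comNzRingType) (v c : nat -> A) (a : A)
    (n : nat) : 'M[A]_n :=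
  \matrix_(r < n, s < n)
    if s == r.+1 :> nat then a
    else if (s <= r)%N then (if s == 0 :> nat then v r else c (r - s)%N) else 0.

Lemma permanent_toeplitz_hessenbergS (A : comNzRingType) (v c : nat -> A)
    (a : A) (n : nat) :
  permanent (toeplitz_hessenberg v c a n.+2) =
    v 0%N * permanent (toeplitz_hessenberg c c a n.+1)
    + a * permanent (toeplitz_hessenberg (v \o succn) c a n.+1).
Proof.
rewrite (expand_permanent_row _ ord0) !big_ord_recl big1 ?addr0 => [|j _].
  rewrite !mxE /=; congr (_ * _ + _ * _); congr permanent;
    apply/matrixP => r s; rewrite !mxE /= /bump /=.
    by rewrite !add1n eqSS ltnS subSS; case: (nat_of_ord s) => [|s'] //=; rewrite subn0.
  by case: (nat_of_ord s).
by rewrite mxE /= mul0r.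
Qed.

Lemma permanent_toeplitz_hessenberg (A : comNzRingType) (v c : nat -> A)
    (a : A) (n : nat) :
  permanent (toeplitz_hessenberg v c a n.+1) =
    \sum_(i < n.+1)
      a ^+ i * v i * permanent (toeplitz_hessenberg c c a (n - i)).
Proof.
elim: n v => [|n IHn] v.
  (* In order 1 there is no superdiagonal, hence a separate base case. *)
  by rewrite (expand_permanent_row _ ord0) !big_ord1 mxE /= mul1r;
    congr (_ * _); congr permanent; apply/matrixP => -[].
rewrite permanent_toeplitz_hessenbergS (IHn (v \o succn)) [RHS]big_ord_recl mul1r.
congr (_ + _).
by rewrite mulr_sumr; apply: eq_bigr => i _; rewrite exprS !mulrA.
Qed.

(** The terms with [n < j] vanish because [F] is zero below 1 and those with
    [k < j] because [t] has no such entry, so the bound [k] of the sums that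
    define [F] and [G] can be replaced by [n], the order of the matrix. The
    weight is [1] for [F] and [j] for [G]. *)
Lemma sum_genFib_trunc (A : comNzRingType) (k : nat) (t : k.-tuple A)
    (w : nat -> A) (n : nat) :
  \sum_(1 <= j < k.+1) w j * tcoef t j * genFib t (n%:Z - j%:Z + 1) =
  \sum_(i < n) w i.+1 * tcoef t i.+1 * genFib t (n - i)%N.
Proof.
pose F j := w j * tcoef t j * genFib t (n%:Z - j%:Z + 1).
have F0 m : (k <= m)%N || (n <= m)%N -> F m.+1 = 0.
  rewrite /F => /orP[km|nm].
    by rewrite /tcoef nth_default ?mulr0 ?mul0r //= size_tuple.
  by rewrite genFib_lt1 ?mulr0 //; lia.
have widen m : (k <= m)%N || (n <= m)%N -> (m <= maxn k n)%N ->
    \sum_(1 <= j < m.+1) F j = \sum_(1 <= j < (maxn k n).+1) F j.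
  move=> h hm; rewrite [RHS](big_cat_nat (n := m.+1)) //=.
  rewrite [X in _ + X]big_nat [X in _ + X]big1 ?addr0 // => -[|j] // /andP[mj _].
  by apply: F0; lia.
rewrite (widen k) ?leqnn ?leq_maxl // -(widen n) ?leqnn ?orbT ?leq_maxr //.
rewrite big_add1 big_mkord; apply: eq_bigr => -[i lt_in] _.
by rewrite /F; congr (_ * genFib t _) => /=; lia.
Qed.

(** The entries are [u ^ (r - s) * tcoef t (r - s + 1)], so [u] amounts to a
    conjugation by a diagonal matrix and does not affect the permanent; the
    recurrence of [F] is what the expansion along the first row gives. *)
Lemma permanent_genFib (K : fieldType) (k : nat) (t : k.-tuple K) (u : K)
    (n : nat) : u != 0 ->
  let c i := u ^+ i * tcoef t i.+1 in
  permanent (toeplitz_hessenberg c c u^-1 n) = genFib t n.+1.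
Proof.
move=> u0 c; elim/ltn_ind: n => -[_|n IHn].
  rewrite /permanent (big_pred1 (1%g : 'S_0)) ?big_ord0 // => s.
  by apply/esym/eqP/permP=> -[].
rewrite permanent_toeplitz_hessenberg.
have -> : Posz n.+2 = Posz n.+1 + 1 by lia.
rewrite genFib_rec //.
under [RHS]eq_bigr => j _ do rewrite -[tcoef t j]mul1r.
rewrite (sum_genFib_trunc t (fun=> 1) n.+1); apply: eq_bigr => i _.
rewrite IHn ?ltnS ?leq_subr // subSn; last by rewrite -ltnS.
by rewrite /c mulrA exprVn mulVf ?expf_neq0 ?mul1r.
Qed.

Lemma permanent_genLucas (K : fieldType) (k : nat) (t : k.-tuple K) (u : K)
    (n : nat) : u != 0 ->
  let c i := u ^+ i * tcoef t i.+1 in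
  permanent (toeplitz_hessenberg (fun i => c i * i.+1%:R) c u^-1 n.+1) =
    genLucas t n.+1.
Proof.
move=> u0 c; rewrite permanent_toeplitz_hessenberg /genLucas.
rewrite (sum_genFib_trunc t (fun j => j%:R) n.+1); apply: eq_bigr => i _.
rewrite permanent_genFib // subSn; last by rewrite -ltnS.
by rewrite /c !mulrA exprVn mulVf ?expf_neq0 // mul1r [_ * _%:R]mulrC.
Qed.

Lemma Hmx_toeplitz_hessenberg (R : realType) (k n : nat) (t : k.-tuple R[i]) :
  let u := 'i%C / tcoef t 2 in
  let c i := u ^+ i * tcoef t i.+1 in
  Hmx t n = toeplitz_hessenberg (fun i => c i * i.+1%:R) c u^-1 n.
Proof.
move=> u c; apply/matrixP => r s; rewrite !mxE /=.
have [sr|sr] := eqVneq (s : nat) r.+1.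
  have -> : r%:Z - s%:Z = -1 by lia.
  have -> : (-1 <= -1 :> int) && (-1 < k%:Z) by lia.
  by rewrite sr /= /u invf_div /exprz /= /tcoef /= invrK mul1r mulrC.
case: leqP => [{}sr|rs]; last by rewrite (_ : (-1 <= _) = false) //; lia.
rewrite subzn //.
have -> : (Posz (r - s) + 1) = Posz (r - s).+1 by lia.
have -> : -1 <= (r - s)%N%:Z by lia.
rewrite /= -[_ ^ _]/(_ ^+ _) -[tcoef t 2 ^ _]/(_ ^+ _).
have hE : 'i%C ^+ (r - s) * (tcoef t (r - s).+1 / tcoef t 2 ^+ (r - s)) = c (r - s)%N.
  by rewrite /c /u expr_div_n mulrCA mulrC -mulrA mulrC.
(* Below the band the entry of the matrix is 0 by definition, and [c] is 0
   because [tcoef t] is 0 beyond [k]. *)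
rewrite hE ltz_nat; case: ltnP => [_|kd].
  by case: eqP => // ->; rewrite subn0.
have c0 : c (r - s)%N = 0 by rewrite /c [tcoef _ _]nth_default ?mulr0 //= size_tuple.
by case: eqP c0 => // ->; rewrite subn0 => ->; rewrite mul0r.
Qed.

Theorem theorem3p2 (R : realType) (k n : nat) (t : k.-tuple R[i])
    (hk : (2 <= k)%N) (hn : (1 <= n)%N) (ht2 : tcoef t 2 != 0) :
  permanent (Hmx t n) = genLucas t n.
Proof.
case: n hn => // n _; rewrite Hmx_toeplitz_hessenberg //.
apply: permanent_genLucas.
rewrite mulf_neq0 ?invr_neq0 //.
by rewrite eq_complex /= oner_eq0 andbF.
Qed.
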